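(* Let $S$ be a Hausdorff countably compact topological semigroup which is algebraically a primitive inverse semigroup, $S=\sum_{i\in\mathscr I}B_{\lambda_i}(G_i)$. Then the family of all sets $S\setminus\big((G_{i_1})_{\alpha_1,\beta_1}\cup\dots\cup(G_{i_k})_{\alpha_k,\beta_k}\big)$, where $k\in\mathbb N$, $i_1,\dots,i_k\in\mathscr I$ and $\alpha_j,\beta_j\in\lambda_{i_j}$, is a base of the topology of $S$ at zero.
   Context: A topological semigroup is a Hausdorff space with jointly continuous associative operation. For a group $G$ and cardinal $\lambda\ge1$, $B_\lambda(G)=(\lambda\times G\times\lambda)\cup\{0\}$ with $(\alpha,a,\beta)(\gamma,b,\delta)=(\alpha,ab,\delta)$ if $\beta=\gamma$ and $0$ otherwise. The orthogonal sum of semigroups $T_\iota$ with zeros is $\{0\}\cup\bigcup_\iota(T_\iota\setminus\{0_\iota\})$ with products computed in $T_\iota$ when both factors lie in the same $T_\iota$ and the product is non-zero, and $0$ otherwise. Primitive inverse semigroups are exactly orthogonal sums $\sum_{i\in\mathscr I}B_{\lambda_i}(G_i)$; we identify $B_{\lambda_i}(G_i)$ with a subsemigroup of $S$ and write $(G_i)_{\alpha,\beta}=\{(\alpha,g,\beta):g\in G_i\}$. *)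

(* Defs.v *)
From Stdlib Require Import Classical ClassicalEpsilon List.
Set Implicit Arguments.

Record Grp := {
  gcar :> Type;
  gmul : gcar -> gcar -> gcar;
  gone : gcar;
  ginv : gcar -> gcar;
  gmulA : forall x y z, gmul x (gmul y z) = gmul (gmul x y) z;
  gmul1 : forall x, gmul gone x = x;
  gmulV : forall x, gmul (ginv x) x = gone
}.

(** The orthogonal sum  S = sum_{i in I} B_{lam i}(G i).
    An element is either the zero [None] or [Some (existT i ((a, g), b))]
    standing for (a, g, b) in B_{lam i}(G i) \ {0}. *)
Definition PrimInv (I : Type) (lam : I -> Type) (G : I -> Grp) : Type :=
  option {i : I & (lam i * G i * lam i)%type}.

Definition pzero {I : Type} {lam : I -> Type} {G : I -> Grp} : PrimInv lam G :=
  None.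

Definition pmul {I : Type} {lam : I -> Type} {G : I -> Grp}
  (x y : PrimInv lam G) : PrimInv lam G :=
  match x, y with
  | Some (existT _ i ((a, g), b)), Some (existT _ j ((c, h), d)) =>
      match excluded_middle_informative (i = j) with
      | left e =>
          let a' := eq_rect i lam a j e in
          let b' := eq_rect i lam b j e in
          let g' := eq_rect i (fun k => gcar (G k)) g j e in
          match excluded_middle_informative (b' = c) with
          | left _ => Some (existT _ j ((a', gmul (G j) g' h), d))
          | right _ => None
          end
      | right _ => None
      end
  | _, _ => None
  end.

Definition block {I : Type} {lam : I -> Type} {G : I -> Grp}
  (i : I) (a b : lam i) : PrimInv lam G -> Prop :=
  fun x => exists g : G i, x = Some (existT _ i ((a, g), b)).

Record is_topology (X : Type) (open : (X -> Prop) -> Prop) : Prop := {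
  open_full : open (fun _ => True);
  open_union : forall F : (X -> Prop) -> Prop,
      (forall U, F U -> open U) -> open (fun x => exists U, F U /\ U x);
  open_inter : forall U V, open U -> open V -> open (fun x => U x /\ V x)
}.

Definition hausdorff (X : Type) (open : (X -> Prop) -> Prop) : Prop :=
  forall x y : X, x <> y ->
    exists U V, open U /\ open V /\ U x /\ V y /\ forall z, ~ (U z /\ V z).

Definition countably_compact (X : Type) (open : (X -> Prop) -> Prop) : Prop :=
  forall U : nat -> X -> Prop, (forall n, open (U n)) ->
    (forall x, exists n, U n x) ->
    exists N, forall x, exists n, n <= N /\ U n x.

Definition jointly_continuous (X : Type) (open : (X -> Prop) -> Prop)
  (m : X -> X -> X) : Prop :=
  forall (x y : X) (W : X -> Prop), open W -> W (m x y) ->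
    exists U V, open U /\ open V /\ U x /\ V y /\
      forall u v, U u -> V v -> W (m u v).

Definition base_at (X : Type) (open : (X -> Prop) -> Prop)
  (B : (X -> Prop) -> Prop) (p : X) : Prop :=
  (forall V, B V -> open V /\ V p) /\
  (forall U, open U -> U p -> exists V, B V /\ forall z, V z -> U z).

Definition zero_family {I : Type} {lam : I -> Type} {G : I -> Grp}
  : (PrimInv lam G -> Prop) -> Prop :=
  fun V => exists l : list {i : I & (lam i * lam i)%type},
    forall x, V x <->
      ~ (exists t, In t l /\ block (projT1 t) (fst (projT2 t)) (snd (projT2 t)) x).

(* Main.v *)
(** The zero is not adherent to a maximal subgroup [H]. Let [U] be a
    neighbourhood of zero whose closure misses the identity; take neighbourhoods
    [A], [B], [V1] of zero and [W] of the identity with [A B] and [V1 W]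
    contained in [U]. If zero were adherent to [H], one could choose [g_n] in
    [H] and in [B] with [g_m^-1 g_n] in [V1] for [m < n]. The inverses [g_n^-1]
    avoid [A], so they accumulate at some [y] in [H]. Then
    [g_m^-1 = (g_m^-1 g_n) g_n^-1] lies in [V1 W y] for every [m], hence the
    identity is adherent to [U], a contradiction. Only single sequences are made
    to accumulate, so neither continuity of inversion nor countable compactness
    of the square is needed.
    Translating, zero is not adherent to any block. As blocks are open, points
    chosen outside a neighbourhood of zero in pairwise distinct blocks would
    have no accumulation point, so all but finitely many blocks lie in it. *)

Require Import Defs.
From Stdlib Require Import Classical ClassicalEpsilon List.
From Stdlib Require Import FunctionalExtensionality PropExtensionality.

(** * Right-hand group laws and recursive choice of sequences *)

Lemma gmulVr (G : Grp) (x : G) : gmul G x (ginv G x) = gone G.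
Proof.
  rewrite <- (gmul1 G (gmul G x (ginv G x))).
  rewrite <- (gmulV G (ginv G x)) at 1.
  rewrite <- gmulA, (gmulA G (ginv G x) x), gmulV, gmul1.
  apply gmulV.
Qed.

Lemma gmul1r (G : Grp) (x : G) : gmul G x (gone G) = x.
Proof. rewrite <- (gmulV G x), gmulA, gmulVr; apply gmul1. Qed.

Lemma sequence_of_list_choice (A : Type) (P : A -> Prop) (R : A -> A -> Prop) :
  (forall l, exists g, P g /\ forall h, In h l -> R h g) ->
  exists f : nat -> A,
    (forall n, P (f n)) /\ forall m n, m < n -> R (f m) (f n).
Proof.
  intros H.
  destruct (choice (fun l g => P g /\ forall h, In h l -> R h g) H) as [c Hc].
  (* [L n] lists the first [n] terms, latest first; the next term is [c (L n)]. *)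
  set (L := fix L n := match n with 0 => nil | S k => c (L k) :: L k end).
  exists (fun n => c (L n)); split.
  - intros n; apply Hc.
  - intros m n Hmn; apply Hc.
    induction Hmn as [|n Hmn IH]; simpl; auto.
Qed.

(** * Neighbourhoods and accumulation points *)

Section Topology.

Context {X : Type} {open : (X -> Prop) -> Prop}.
Hypothesis Htop : is_topology open.

Definition nbhd (p : X) (Q : X -> Prop) : Prop :=
  exists U, open U /\ U p /\ forall x, U x -> Q x.

Lemma open_of_nbhd (V : X -> Prop) : (forall x, V x -> nbhd x V) -> open V.
Proof.
  intros H.
  replace V with
    (fun x => exists U, (open U /\ forall z, U z -> V z) /\ U x).
  - apply (open_union Htop); intros U [HU _]; exact HU.
  - apply functional_extensionality; intros x.
    apply propositional_extensionality; split.
    + intros (U & [_ HU] & Ux); auto.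
    + intros Vx; destruct (H x Vx) as (U & HU & Ux & UV); eauto.
Qed.

Lemma nbhd_and (p : X) (P Q : X -> Prop) :
  nbhd p P -> nbhd p Q -> nbhd p (fun x => P x /\ Q x).
Proof.
  intros (U & oU & Up & UP) (V & oV & Vp & VQ).
  exists (fun x => U x /\ V x); split.
  - apply (open_inter Htop); assumption.
  - split; [auto | intros x [Ux Vx]; auto].
Qed.

Lemma nbhd_forall_list (A : Type) (p : X) (Q : A -> X -> Prop) (l : list A) :
  (forall a, In a l -> nbhd p (Q a)) ->
  nbhd p (fun x => forall a, In a l -> Q a x).
Proof.
  induction l as [|a l IH]; intros H.
  - exists (fun _ => True); split; [apply (open_full Htop) | simpl; tauto].
  - destruct (nbhd_and _ _ _ (H a (or_introl eq_refl))
                (IH (fun b Hb => H b (or_intror Hb)))) as (U & oU & Up & HU).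
    exists U; split; [exact oU | split; [exact Up |]].
    intros x Ux b [<- | Hb]; destruct (HU x Ux); auto.
Qed.

(** Otherwise the space is covered by the open sets indexed by [N], each the union of all open sets
    missing every [s n] with [N <= n]. A finite subcover with indices up to [N] would fail to
    contain [s N]. *)
Lemma countably_compact_accumulation (Hcc : countably_compact open)
  (s : nat -> X) :
  exists p, forall U, open U -> U p -> forall N, exists n, N <= n /\ U (s n).
Proof.
  apply NNPP; intros Hno.
  destruct (Hcc (fun N x => exists U,
                     (open U /\ forall n, N <= n -> ~ U (s n)) /\ U x))
    as [N HN].
  - intros N; apply (open_union Htop); intros U [HU _]; exact HU.
  - intros x; apply NNPP; intros Hx; apply Hno; exists x.
    intros U oU Ux N; apply NNPP; intros Hn; apply Hx; exists N, U.
    split; [split; [exact oU | intros n Hle Un; apply Hn; eauto] | exact Ux].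
  - destruct (HN (s N)) as (k & Hk & U & [_ HU] & Us).
    exact (HU N Hk Us).
Qed.

(** * Translations and subgroups in a topological semigroup *)

Section Semigroup.

Variable m : X -> X -> X.
Hypothesis Hcont : jointly_continuous open m.

Lemma open_translate_l (c : X) (W : X -> Prop) :
  open W -> open (fun x => W (m c x)).
Proof.
  intros oW; apply open_of_nbhd; intros x Wx.
  destruct (Hcont _ _ _ oW Wx) as (U & V & _ & oV & Uc & Vx & H).
  exists V; auto.
Qed.

Lemma open_translate_r (c : X) (W : X -> Prop) :
  open W -> open (fun x => W (m x c)).
Proof.
  intros oW; apply open_of_nbhd; intros x Wx.
  destruct (Hcont _ _ _ oW Wx) as (U & V & oU & _ & Ux & Vc & H).
  exists U; auto.
Qed.

(** Here [phi_closed] says that the image of [phi] together with [z] is closed, so accumulation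
    points other than [z] stay in the image. *)
Lemma zero_not_adherent_to_subgroup (Hhaus : hausdorff open)
  (Hcc : countably_compact open) (z : X)
  (zl : forall x, m z x = z) (zr : forall x, m x z = z)
  (G : Grp) (phi : G -> X)
  (phiM : forall g h, phi (gmul G g h) = m (phi g) (phi h))
  (phi1 : phi (gone G) <> z)
  (phi_closed : forall x, x <> z -> (forall g, x <> phi g) ->
     nbhd x (fun y => forall g, y <> phi g)) :
  nbhd z (fun x => forall g, x <> phi g).
Proof.
  destruct (Hhaus z (phi (gone G)) (not_eq_sym phi1))
    as (U & O & oU & oO & Uz & O1 & UO).
  assert (U (m z (phi (gone G)))) as Uz1 by (rewrite zl; exact Uz).
  destruct (Hcont _ _ _ oU Uz1) as (V1 & W & oV1 & oW & V1z & W1 & V1W).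
  assert (U (m z z)) as Uzz by (rewrite zl; exact Uz).
  destruct (Hcont _ _ _ oU Uzz) as (A & B & oA & oB & Az & Bz & AB).
  apply NNPP; intros Hadh.
  destruct (sequence_of_list_choice G (fun g => B (phi g))
              (fun h g => V1 (m (phi (ginv G h)) (phi g)))) as (g & gB & gV1).
  (* Each earlier [h] imposes a condition that holds near [z], since [phi (ginv G h)] times [z] is
     [z]; finitely many such conditions still define a neighbourhood of [z]. *)
  { intros l; apply NNPP; intros Hno; apply Hadh.
    assert (nbhd z (fun x => B x /\
        forall h, In h l -> V1 (m (phi (ginv G h)) x))) as (N & oN & Nz & HN).
    { apply nbhd_and.
      - exists B; auto.
      - apply nbhd_forall_list; intros h _.
        exists (fun x => V1 (m (phi (ginv G h)) x)).
        split; [apply open_translate_l; exact oV1 | rewrite zr; auto]. }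
    exists N; split; [exact oN | split; [exact Nz |]].
    intros x Nx h ->; apply Hno; exists h; exact (HN _ Nx). }
  destruct (countably_compact_accumulation Hcc (fun n => phi (ginv G (g n))))
    as [p Hp].
  assert (p <> z) as pz.
  { intros ->; destruct (Hp A oA Az 0) as (n & _ & An).
    apply (UO (phi (gone G))); split; [| exact O1].
    rewrite <- (gmulV G (g n)), phiM; auto. }
  assert (exists y, p = phi y) as [y ->].
  { apply NNPP; intros Hno.
    destruct (phi_closed p pz) as (N & oN & Np & HN).
    { intros y Hy; apply Hno; eauto. }
    destruct (Hp N oN Np 0) as (n & _ & Nn).
    exact (HN _ Nn _ eq_refl). }
  (* Right translation by the inverse of [y] moves the accumulation point to the identity. *)
  assert (forall C, open C -> C (phi (gone G)) -> forall N, exists n,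
            N <= n /\ C (m (phi (ginv G (g n))) (phi (ginv G y)))) as Hp1.
  { intros C oC C1 N.
    apply (Hp _ (open_translate_r (phi (ginv G y)) _ oC)).
    rewrite <- phiM, gmulVr; exact C1. }
  destruct (Hp1 O oO O1 0) as (k & _ & Ok).
  destruct (Hp1 W oW W1 (S k)) as (n & kn & Wn).
  (* The product of [g_k^-1 g_n] and [g_n^-1 y^-1] is [g_k^-1 y^-1], which thus lies in both [U] and
     [O]. *)
  refine (UO _ (conj (V1W _ _ (gV1 k n kn) Wn) _)).
  rewrite <- !phiM, <- !gmulA, (gmulA G (g n)), gmulVr, gmul1, phiM.
  exact Ok.
Qed.

End Semigroup.

End Topology.

(** * Algebra and topology of the blocks *)

Section PrimitiveInverse.

Context {I : Type} {lam : I -> Type} {G : I -> Grp}.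

Definition elem (i : I) (a : lam i) (g : G i) (b : lam i) : PrimInv lam G :=
  Some (existT _ i ((a, g), b)).

(** Forgetting the group coordinate leaves the index of the block containing the element. *)
Definition tag (p : {i : I & (lam i * G i * lam i)%type})
  : {i : I & (lam i * lam i)%type} :=
  existT _ (projT1 p) (fst (fst (projT2 p)), snd (projT2 p)).

Lemma block_tag (t : {i : I & (lam i * lam i)%type}) (x : PrimInv lam G) :
  block (projT1 t) (fst (projT2 t)) (snd (projT2 t)) x <->
  exists p, x = Some p /\ tag p = t.
Proof.
  split.
  - destruct t as [i [a b]]; intros [g ->]; eexists; split; reflexivity.
  - intros ([j [[c g] d]] & -> & <-); exists g; reflexivity.
Qed.

Lemma pmul_elem (i : I) (a b c : lam i) (g h : G i) :
  pmul (elem i a g b) (elem i b h c) = elem i a (gmul (G i) g h) c.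
Proof.
  unfold pmul, elem.
  destruct (excluded_middle_informative (i = i)) as [e | ne]; [| now elim ne].
  rewrite (proof_irrelevance _ e eq_refl); simpl.
  destruct (excluded_middle_informative (b = b)) as [_ | ne];
    [reflexivity | now elim ne].
Qed.

Lemma pmul_nonzero (i j : I) (a b : lam i) (c d : lam j) (g : G i) (h : G j) :
  pmul (elem i a g b) (elem j c h d) <> pzero ->
  existT lam i b = existT lam j c.
Proof.
  unfold pmul, elem.
  destruct (excluded_middle_informative (i = j)) as [e | ne]; [| now intros []].
  destruct e; simpl.
  destruct (excluded_middle_informative (b = c)) as [-> | ne];
    [reflexivity | now intros []].
Qed.

Lemma pmul0l (x : PrimInv lam G) : pmul pzero x = pzero.
Proof. reflexivity. Qed.

Lemma pmul0r (x : PrimInv lam G) : pmul x pzero = pzero.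
Proof. destruct x as [[i [[a g] b]]|]; reflexivity. Qed.

Lemma block_sandwich (i : I) (a b : lam i) (x : PrimInv lam G) :
  pmul (elem i a (gone (G i)) a) x <> pzero ->
  pmul x (elem i b (gone (G i)) b) <> pzero ->
  block i a b x.
Proof.
  destruct x as [[j [[c g] d]]|]; [| now intros []].
  change (Some _) with (elem j c g d); intros Hl Hr.
  apply pmul_nonzero in Hl; apply pmul_nonzero in Hr.
  assert (i = j) as e by exact (f_equal (@projT1 _ _) Hl).
  destruct e.
  apply inj_pair2 in Hl; apply inj_pair2 in Hr; subst.
  exists g; reflexivity.
Qed.

Context {open : (PrimInv lam G -> Prop) -> Prop}.
Hypothesis Htop : is_topology open.
Hypothesis Hhaus : hausdorff open.
Hypothesis Hcont : jointly_continuous open pmul.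

(** Points are closed, so the nonzero elements form an open set. A block is the intersection of the
    preimages of this set under translations by two idempotents, hence open. *)
Lemma nbhd_block (p : {i : I & (lam i * G i * lam i)%type}) :
  nbhd (open := open) (Some p) (fun x => exists q, x = Some q /\ tag q = tag p).
Proof.
  assert (open (fun x => x <> pzero)) as onz.
  { apply (open_of_nbhd Htop); intros x Hx.
    destruct (Hhaus _ _ Hx) as (U & V & oU & _ & Ux & V0 & UV).
    exists U; split; [exact oU | split; [exact Ux |]].
    intros y Uy ->; exact (UV _ (conj Uy V0)). }
  destruct p as [i [[a g] b]].
  exists (fun x => pmul (elem i a (gone (G i)) a) x <> pzero /\
                   pmul x (elem i b (gone (G i)) b) <> pzero).
  split; [| split].
  - apply (open_inter Htop).
    + exact (open_translate_l Htop _ Hcont _ _ onz).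
    + exact (open_translate_r Htop _ Hcont _ _ onz).
  - change (Some _) with (elem i a g b).
    rewrite !pmul_elem; split; discriminate.
  - intros x [Hl Hr].
    apply (proj1 (block_tag (existT _ i (a, b)) x)).
    exact (block_sandwich _ _ _ _ Hl Hr).
Qed.

Hypothesis Hcc : countably_compact open.

Lemma zero_not_adherent_to_block (i : I) (a b : lam i) :
  nbhd (open := open) pzero (fun x => ~ block i a b x).
Proof.
  destruct (zero_not_adherent_to_subgroup Htop _ Hcont Hhaus Hcc
              pzero pmul0l pmul0r (G i) (fun g => elem i a g a))
    as (U & oU & U0 & HU).
  - intros g h; symmetry; apply pmul_elem.
  - discriminate.
  - intros [p|] Hx Hg; [| now elim Hx].
    destruct (nbhd_block p) as (U & oU & Up & HU).
    exists U; split; [exact oU | split; [exact Up |]].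
    intros y Uy g ->.
    destruct (HU _ Uy) as (q & [= <-] & Ht).
    destruct (proj2 (block_tag (existT _ i (a, a)) (Some p))) as [h Hh].
    { exists p; split; [reflexivity | symmetry; exact Ht]. }
    exact (Hg h Hh).
  (* Right translation by [(b, 1, a)] fixes zero and carries the block into the maximal subgroup at
     [a]. *)
  - exists (fun x => U (pmul x (elem i b (gone (G i)) a))).
    split; [exact (open_translate_r Htop _ Hcont _ _ oU) | split; [exact U0 |]].
    intros x Ux [g ->]; change (Some _) with (elem i a g b) in Ux.
    rewrite pmul_elem in Ux; exact (HU _ Ux _ eq_refl).
Qed.

Lemma nbhd_zero_cofinite (U : PrimInv lam G -> Prop) :
  open U -> U pzero ->
  exists l, forall p, ~ In (tag p) l -> U (Some p).
Proof.
  intros oU U0; apply NNPP; intros Hno.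
  destruct (sequence_of_list_choice _ (fun p => ~ U (Some p))
              (fun q p => tag q <> tag p)) as (s & sU & sR).
  { intros l; apply NNPP; intros Hl; apply Hno; exists (map tag l).
    intros p Hp; apply NNPP; intros Up; apply Hl; exists p.
    split; [exact Up |].
    intros q Hq e; apply Hp; rewrite <- e; apply in_map; exact Hq. }
  destruct (countably_compact_accumulation Htop Hcc (fun n => Some (s n)))
    as [[p|] Hp].
  (* The block of a nonzero accumulation point would contain two terms, whose tags differ by
     choice. *)
  - destruct (nbhd_block p) as (V & oV & Vp & HV).
    destruct (Hp V oV Vp 0) as (k & _ & Vk).
    destruct (Hp V oV Vp (S k)) as (n & kn & Vn).
    destruct (HV _ Vk) as (q & [= <-] & Hk).
    destruct (HV _ Vn) as (r & [= <-] & Hn).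
    apply (sR k n kn); congruence.
  - destruct (Hp U oU U0 0) as (n & _ & Un); exact (sU n Un).
Qed.

End PrimitiveInverse.

Theorem theorem3p10 (I : Type) (lam : I -> Type) (G : I -> Grp)
  (lam_ne : forall i, inhabited (lam i))
  (open : (PrimInv lam G -> Prop) -> Prop)
  (Htop : is_topology open)
  (Hhaus : hausdorff open)
  (Hcc : countably_compact open)
  (Hcont : jointly_continuous open pmul) :
  base_at open zero_family pzero.
Proof.
  split.
  - intros V [l Hl].
    assert (V pzero) as V0.
    { apply Hl; intros (t & _ & g & [=]). }
    split; [| exact V0].
    apply (open_of_nbhd Htop); intros [p|] Vx.
    (* A nonzero point of [V] brings its whole block, which is none of the removed ones. *)
    + destruct (nbhd_block Htop Hhaus Hcont p) as (U & oU & Up & HU).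
      exists U; split; [exact oU | split; [exact Up |]].
      intros x Ux; apply Hl; intros (t & Ht & Hx).
      destruct (HU x Ux) as (q & -> & Hq).
      apply block_tag in Hx; destruct Hx as (r & [= <-] & Hr).
      apply (proj1 (Hl _) Vx); exists t; split; [exact Ht |].
      apply block_tag; exists p; split; [reflexivity | congruence].
    + destruct (nbhd_forall_list Htop _ pzero
                  (fun (t : {i : I & (lam i * lam i)%type}) (x : PrimInv lam G) =>
                     ~ block (projT1 t) (fst (projT2 t)) (snd (projT2 t)) x) l)
        as (U & oU & U0 & HU).
      { intros t _; apply zero_not_adherent_to_block; assumption. }
      exists U; split; [exact oU | split; [exact U0 |]].
      intros x Ux; apply Hl; intros (t & Ht & Hx).
      exact (HU x Ux t Ht Hx).
  - intros U oU U0.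
    destruct (nbhd_zero_cofinite Htop Hhaus Hcont Hcc U oU U0) as [l Hl].
    eexists; split; [exists l; intros x; apply iff_refl |].
    intros [p|] Hx; [| exact U0].
    apply Hl; intros Hin; apply Hx; exists (tag p); split; [exact Hin |].
    apply block_tag; eauto.
Qed.
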